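(* A graph $G$ is meshed if and only if for every metric triangle $uvw$ of $G$ there is a shortest path $P(u,v)$ between $u$ and $v$ such that all vertices of $P(u,v)$ are at the same distance from $w$.
   Context: All graphs are finite, simple, unweighted, undirected and connected, with shortest-path distance $d$. The interval is $I(u,v)=\{z: d(u,z)+d(z,v)=d(u,v)\}$. Three vertices $u,v,w$ form a metric triangle $uvw$ if the intervals $I(u,v),I(v,w),I(u,w)$ pairwise intersect only in their common endpoints. $G$ is meshed if for any three vertices $u,v,w$ with $d(v,w)=2$ there is a common neighbor $x$ of $v$ and $w$ with $2d(u,x)\le d(u,v)+d(u,w)$. *)

(* Defs.v *)
From mathcomp Require Import all_boot.

Set Implicit Arguments.
Unset Strict Implicit.
Unset Printing Implicit Defensive.

Record cgraph := CGraph {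
  vertex :> finType;
  edge : rel vertex;
  edge_sym : symmetric edge;
  edge_irrefl : irreflexive edge;
  edge_connected : forall x y : vertex, connect edge x y
}.

Section Graph.

Variable G : cgraph.
Implicit Types u v w x y : G.

(* As in path.v, a path is given by its first vertex u and the list p of the
   vertices that follow it; thus u :: p lists its vertices and its length
   (number of edges) is size p. *)
Definition is_path u v (p : seq G) : bool :=
  [&& path (@edge G) u p, last u p == v & uniq (u :: p)].

Definition has_path_of_size u v (n : nat) : bool :=
  [exists p : n.-tuple G, is_path u v p].

Lemma exists_path u v : exists n, has_path_of_size u v n.
Proof.
have /connectP[p e_p ->] := edge_connected u v.
case/shortenP: e_p => q e_q Uq _; exists (size q).
by apply/existsP; exists (in_tuple q); rewrite /is_path e_q eqxx.
Qed.

Definition dist u v : nat := ex_minn (exists_path u v).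

Definition interval u v : {set G} := [set z | dist u z + dist z v == dist u v].

(* The three vertices need not be distinct, but if two of them coincide then
   these equations force all three to coincide. *)
Definition metric_triangle u v w : Prop :=
  [/\ interval u v :&: interval v w = [set v],
      interval v w :&: interval u w = [set w] &
      interval u v :&: interval u w = [set u]].

Definition shortest_path u v (p : seq G) : bool :=
  is_path u v p && (size p == dist u v).

End Graph.

Definition meshed (G : cgraph) : Prop :=
  forall u v w : G, dist v w = 2 ->
    exists x : G, [/\ edge v x, edge w x & 2 * dist u x <= dist u v + dist u w].

(* Main.v *)
Require Import Defs.
From mathcomp Require Import all_boot.
From mathcomp Require Import zify.

Set Implicit Arguments.
Unset Strict Implicit.
Unset Printing Implicit Defensive.

(** If [G] is meshed, a geodesic from [u] to [v] that minimises the sum of the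
    distances to [w] is convex with respect to the distance to [w], because any
    inner vertex may be exchanged for the vertex given by meshedness.  In a
    metric triangle the distance to [w] cannot decrease along the first step
    from [u] nor along the first step from [v], so it is constant.

    Conversely, if [d(v, w) = 2], the path condition is applied to a
    quasi-median [a b c] of [u, v, w]: a metric triangle with geodesics
    [u - a - b - v], [v - b - c - w] and [u - a - c - w].  As
    [d(b, c) <= 2], a common neighbour of [v] and [w] is found in each case. *)

(** Convexity carries the inequality at 0 forward, making [h] nondecreasing, and the inequality at
    [n] backward, making it nonincreasing. *)
Lemma convex_flat (n : nat) (h : nat -> nat) :
    (0 < n -> h 0 <= h 1) -> (0 < n -> h n <= h n.-1) ->
    (forall i, i.+1 < n -> 2 * h i.+1 <= h i + h i.+2) ->
  forall i, i <= n -> h i = h 0.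
Proof.
move=> h01 hn convh.
have incr i : i < n -> h i <= h i.+1.
  elim: i => [|i IHi] lt_in; first exact: h01.
  have := convh i lt_in; have := IHi (ltnW lt_in); lia.
have decr j i : i + j.+1 = n -> h i.+1 <= h i.
  elim: j i => [|j IHj] i def_n.
    by move: hn; rewrite -def_n addn1 /=; apply.
  have /IHj : i.+1 + j.+1 = n by lia.
  have /convh : i.+1 < n by lia.
  lia.
elim=> // i IHi lt_in; rewrite -IHi ?(ltnW lt_in) //.
have := incr i lt_in; have /decr : i + (n - i.+1).+1 = n by lia.
lia.
Qed.

(** * Distances, walks and geodesics *)

Section Distance.

Variable G : cgraph.
Implicit Types (u v w x y z : G) (g : nat -> G) (n i j : nat).

Lemma dist_le_size u v p :
  path (@edge G) u p -> last u p = v -> dist u v <= size p.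
Proof.
move=> e_p <-; case/shortenP: e_p => q e_q Uq sub_qp.
apply: leq_trans (_ : size q <= _); last first.
  by apply: uniq_leq_size sub_qp; case/andP: Uq.
rewrite /dist; case: ex_minnP => m _; apply.
by apply/existsP; exists (in_tuple q); rewrite /is_path e_q eqxx.
Qed.

Lemma dist_geodesic u v :
  exists p, [/\ path (@edge G) u p, last u p = v & size p = dist u v].
Proof.
rewrite /dist; case: ex_minnP => m /existsP[p /and3P[e_p /eqP last_p _]] _.
by exists p; rewrite size_tuple.
Qed.

Lemma distxx u : dist u u = 0.
Proof. by apply/eqP; rewrite -leqn0 (@dist_le_size u u [::]). Qed.

Lemma dist_eq0 u v : dist u v = 0 -> u = v.
Proof. by have [[|x p] [_ <- <-]] := dist_geodesic u v. Qed.

Lemma dist_edge u v : edge u v -> dist u v <= 1.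
Proof. by move=> e_uv; apply: (@dist_le_size u v [:: v]); rewrite //= e_uv. Qed.

Lemma edge_dist1 u v : dist u v = 1 -> edge u v.
Proof.
have [[|x [|y p]] [/= e_p <- <-]] := dist_geodesic u v => // _.
by case/andP: e_p.
Qed.

Lemma dist_triangle v u w : dist u w <= dist u v + dist v w.
Proof.
have [p [e_p last_p <-]] := dist_geodesic u v.
have [q [e_q last_q <-]] := dist_geodesic v w.
by rewrite -size_cat; apply: dist_le_size; rewrite ?cat_path ?last_cat last_p ?e_p.
Qed.

Lemma dist_sym u v : dist u v = dist v u.
Proof.
wlog suff le_d : u v / dist v u <= dist u v.
  by apply/eqP; rewrite eqn_leq !le_d.
have [p [e_p <- <-]] := dist_geodesic u v.
rewrite -[size p](size_belast u) -size_rev; apply: dist_le_size.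
  by rewrite rev_path (eq_path (e' := @edge G)) // => x y; rewrite edge_sym.
by case: p {e_p} => //= x p; rewrite rev_cons last_rcons.
Qed.

Lemma in_interval x u v : (x \in interval u v) = (dist u x + dist x v == dist u v).
Proof. by rewrite inE. Qed.

(** Walks are functions on [nat], of which only the values up to [n] matter, so that exchanging one
    vertex is a change at one index. *)
Definition walk g n := forall i, i < n -> edge (g i) (g i.+1).

Lemma walk_dist g n i j : walk g n -> i <= j <= n -> dist (g i) (g j) <= j - i.
Proof.
move=> e_g; elim: j => [|j IHj] le_ijn.
  by rewrite (_ : i = 0) ?distxx //; lia.
have [eq_ij | lt_ij] : i = j.+1 \/ i <= j by lia.
  by rewrite eq_ij distxx.
have := dist_triangle (g j) (g i) (g j.+1).
have /e_g/dist_edge : j < n by lia.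
have /IHj : i <= j <= n by lia.
lia.
Qed.

(** The walk bounds its pieces by [i], [j - i] and [n - j]; these add up to the distance between the
    ends, so every bound is attained. *)
Lemma geodesic_dist g n i j :
  walk g n -> dist (g 0) (g n) = n -> i <= j <= n -> dist (g i) (g j) = j - i.
Proof.
move=> e_g d_n le_ijn; have := walk_dist e_g le_ijn.
have /(walk_dist e_g) : 0 <= i <= n by lia.
have /(walk_dist e_g) : j <= n <= n by lia.
have := dist_triangle (g i) (g 0) (g n).
have := dist_triangle (g j) (g i) (g n).
lia.
Qed.

Lemma geodesic_walk u v :
  exists g, [/\ walk g (dist u v), g 0 = u & g (dist u v) = v].
Proof.
have [p [e_p <- <-]] := dist_geodesic u v.
exists (nth u (u :: p)); split=> // [i lt_i|]; last by rewrite -last_nth.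
exact: (pathP u e_p).
Qed.

(** The list in [is_path] omits the first vertex, hence the shifted index. Vertices are distinct
    because their distances from [g 0] are their indices. *)
Lemma geodesic_shortest_path g n : walk g n -> dist (g 0) (g n) = n ->
  shortest_path (g 0) (g n) (mkseq (fun i => g i.+1) n).
Proof.
move=> e_g d_n; rewrite /shortest_path /is_path size_mkseq d_n eqxx andbT.
have def_s : g 0 :: mkseq (fun i => g i.+1) n = mkseq g n.+1.
  by rewrite /mkseq /= (iotaDl 1 0) -map_comp.
apply/and3P; split.
- apply/(pathP (g 0)) => i; rewrite size_mkseq def_s => lt_in.
  by rewrite !nth_mkseq ?e_g // ltnW.
- by rewrite (last_nth (g 0)) def_s size_mkseq nth_mkseq.
- rewrite def_s; apply/mkseq_uniqP => i j lt_i lt_j eq_g.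
  rewrite !inE in lt_i lt_j.
  have /(geodesic_dist e_g d_n) : 0 <= i <= n by lia.
  have /(geodesic_dist e_g d_n) : 0 <= j <= n by lia.
  by rewrite eq_g => -> ; lia.
Qed.

(** * From meshedness to paths equidistant from the third vertex *)

Lemma meshed_convex_geodesic u v w : meshed G ->
  exists g, [/\ walk g (dist u v), g 0 = u, g (dist u v) = v &
    forall i, i.+1 < dist u v ->
      2 * dist w (g i.+1) <= dist w (g i) + dist w (g i.+2)].
Proof.
move=> meshG; have [g [e_g g0 gn]] := geodesic_walk u v.
(* Induction on a bound [m] for the sum of distances to [w], over all geodesics from [u] to [v]. *)
move: {2}(\sum_(i < (dist u v).+1) _) (leqnn (\sum_(i < (dist u v).+1) dist w (g i))).
move=> m; elim: m g e_g g0 gn => [|m IHm] g e_g g0 gn le_m.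
all: set n := dist u v in e_g gn le_m *.
all: have d_n : dist (g 0) (g n) = n by rewrite g0 gn.
  exists g; split=> // i lt_in.
  have h0 j : j <= n -> dist w (g j) = 0.
    move=> le_jn; apply/eqP; rewrite -leqn0; apply: leq_trans le_m.
    by rewrite (bigD1 (Ordinal (le_jn : j < n.+1))) //= leq_addr.
  by rewrite !h0 //; lia.
have [/forallP convg | /forallPn[i]] := boolP
    [forall i : 'I_n, (i.+1 < n) ==>
      (2 * dist w (g i.+1) <= dist w (g i) + dist w (g i.+2))].
  exists g; split=> // i lt_in.
  by have /implyP := convg (Ordinal (ltnW lt_in)); apply.
rewrite negb_imply -ltnNge => /andP[lt_in gt_i].
have d2 : dist (g i) (g i.+2) = 2.
  by rewrite (geodesic_dist e_g d_n); lia.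
have [x [e_ix e_xi le_x]] := meshG w _ _ d2.
(* Where convexity fails, [x] is strictly closer to [w] than [g i.+1], so this exchange lowers the
   sum. *)
pose g' j := if j == i.+1 then x else g j.
apply: (IHm g').
- move=> j lt_jn; rewrite /g' eqSS.
  case: (j =P i.+1) => [-> | _]; first by rewrite gtn_eqF // edge_sym.
  by case: (j =P nat_of_ord i) => [-> | _] //; apply: e_g.
- by rewrite /g'.
- by rewrite -/n /g' gtn_eqF.
- have lt_i : i.+1 < n.+1 by lia.
  rewrite -/n (bigD1 (Ordinal lt_i)) //= {1}/g' eqxx.
  rewrite (eq_bigr (fun j : 'I_n.+1 => dist w (g j))); last first.
    by move=> j; rewrite /g' -val_eqE /= => /negPf->.
  move: le_m; rewrite (bigD1 (Ordinal lt_i)) //=.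
  lia.
Qed.

Lemma meshed_triangle_path u v w : meshed G -> metric_triangle u v w ->
  exists2 p : seq G, shortest_path u v p &
    forall x y, x \in u :: p -> y \in u :: p -> dist x w = dist y w.
Proof.
move=> meshG [Iv _ Iu].
have [g [e_g g0 gn convg]] := meshed_convex_geodesic u v w meshG.
set n := dist u v in e_g gn convg.
have d_n : dist (g 0) (g n) = n by rewrite g0 gn.
have d_g i j : i <= j <= n -> dist (g i) (g j) = j - i by exact: geodesic_dist.
have flat : forall i, i <= n -> dist w (g i) = dist w (g 0).
  apply: (@convex_flat n (fun i => dist w (g i))) => // n_gt0.
  (* A first step towards [w] would put [g 1] in both intervals at [u], forcing [g 1 = u]; the other
     end is treated likewise. *)
  - rewrite leqNgt g0; apply/negP => lt_w.
    have := d_g 0 1 n_gt0; rewrite g0 => d_u.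
    have : g 1 \in interval u v :&: interval u w.
      have := d_g 1 n; rewrite gn n_gt0 leqnn => /(_ isT) d_v.
      have := dist_triangle (g 1) u w.
      rewrite in_setI !in_interval -/n (dist_sym u w) (dist_sym (g 1) w).
      lia.
    by rewrite Iu inE => /eqP eq_g; rewrite eq_g distxx in d_u.
  - rewrite leqNgt gn; apply/negP => lt_w.
    have := d_g n.-1 n; rewrite gn leq_pred leqnn => /(_ isT) d_v.
    have : g n.-1 \in interval u v :&: interval v w.
      have := d_g 0 n.-1 (leq_pred n); rewrite g0 => d_u.
      have := dist_triangle (g n.-1) v w.
      rewrite in_setI !in_interval -/n (dist_sym v (g _)).
      rewrite (dist_sym v w) (dist_sym (g _) w).
      lia.
    by rewrite Iv inE => /eqP eq_g; rewrite eq_g distxx in d_v; lia.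
exists (mkseq (fun i => g i.+1) n).
  by rewrite -{1}g0 -gn; apply: geodesic_shortest_path.
suff flat_s x : x \in u :: mkseq (fun i => g i.+1) n -> dist x w = dist w u.
  by move=> x y /flat_s-> /flat_s->.
rewrite inE dist_sym => /predU1P[-> // | /mapP[i]].
by rewrite mem_iota => /andP[_ lt_in] ->; rewrite flat // g0.
Qed.

(** * From equidistant paths to meshedness *)

(* A triple of maximal total distance from [u, v, w] is a metric triangle: a
   vertex [z] in two of its intervals could replace their common end. *)
Lemma quasi_median u v w : exists a b c, [/\ metric_triangle a b c,
  dist u v = dist u a + dist a b + dist b v,
  dist v w = dist v b + dist b c + dist c w &
  dist u w = dist u a + dist a c + dist c w].
Proof.
pose P (t : G * G * G) := let: (a, b, c) := t in
  [&& dist u v == dist u a + dist a b + dist b v,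
      dist v w == dist v b + dist b c + dist c w &
      dist u w == dist u a + dist a c + dist c w].
pose F (t : G * G * G) := let: (a, b, c) := t in dist u a + dist v b + dist w c.
have P0 : P (u, v, w) by rewrite /P !distxx; lia.
case: (arg_maxnP F P0) => [[[a b] c]] /and3P[/eqP d_uv /eqP d_vw /eqP d_uw] maxF.
exists a, b, c; split=> //; split.
all: apply/setP => z; rewrite in_setI in_set1 !in_interval.
all: apply/andP/eqP => [[/eqP d1 /eqP d2] | ->]; last by rewrite !distxx; lia.
(* Replacing the common end by [z] preserves [P] and raises [F] by exactly this distance, which
   maximality makes 0. *)
all: apply: dist_eq0.
- have := maxF (a, z, c).
  have := dist_triangle z u v; have := dist_triangle a u z.
  have := dist_triangle z v w; have := dist_triangle c z w.
  have := dist_triangle b v z; rewrite /P /F.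
  have := dist_sym v b; have := dist_sym v z; have := dist_sym z b.
  by lia.
- have := maxF (a, b, z).
  have := dist_triangle z u w; have := dist_triangle a u z.
  have := dist_triangle z v w; have := dist_triangle b v z.
  have := dist_triangle c z w; rewrite /P /F.
  have := dist_sym w c; have := dist_sym w z; have := dist_sym z c.
  by lia.
- have := maxF (z, b, c).
  have := dist_triangle z u v; have := dist_triangle b z v.
  have := dist_triangle z u w; have := dist_triangle c z w.
  have := dist_triangle a u z; rewrite /P /F.
  have := dist_sym a z.
  by lia.
Qed.

Lemma common_neighbor v w : dist v w = 2 ->
  exists x, [/\ dist v x = 1 & dist x w = 1].
Proof.
move=> d2; have [g [e_g g0 gn]] := geodesic_walk v w.
rewrite d2 in e_g gn; rewrite -g0 -gn in d2 *.
by exists (g 1); rewrite !(geodesic_dist e_g d2).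
Qed.

Lemma triangle_path_meshed :
    (forall u v w : G, metric_triangle u v w ->
       exists2 p : seq G, shortest_path u v p &
         forall x y : G, x \in u :: p -> y \in u :: p -> dist x w = dist y w) ->
  meshed G.
Proof.
move=> flatG u v w d_vw.
suff [x [d_vx d_xw le_x]] : exists x,
    [/\ dist v x = 1, dist x w = 1 & 2 * dist u x <= dist u v + dist u w].
  exists x; split=> //; first exact: edge_dist1.
  by rewrite edge_sym edge_dist1.
have [a [b [c [[Iab Ibc Iac] Duv Dvw Duw]]]] := quasi_median u v w.
(* Reordered so that the path runs from [b] to [c] with distances taken to [a]. *)
have tri_bca : metric_triangle b c a.
  have sI x y : interval x y = interval y x.
    by apply/setP=> z; rewrite !inE (dist_sym x y) addnC (dist_sym x) (dist_sym z).
  split; first by rewrite (sI c a).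
    by rewrite (sI c a) (sI b a) setIC.
  by rewrite (sI b a) setIC.
have [p /andP[/and3P[e_p /eqP last_p _] /eqP size_p] flat_p] := flatG _ _ _ tri_bca.
have eq_d_a : dist a b = dist a c.
  rewrite ![dist a _]dist_sym; apply: flat_p; first exact: mem_head.
  by rewrite -last_p mem_last.
have [bc0 | [bc1 | bc2]] : dist b c = 0 \/ dist b c = 1 \/ dist b c = 2 by lia.
(* Here [b] is on a geodesic from [v] to [w]. If it is an end, that end is on a geodesic from [u] to
   the other, and any common neighbor works; otherwise [b] itself does. *)
- have eq_bc := dist_eq0 bc0; rewrite -eq_bc in Dvw Duw.
  have [bv0 | [bv1 | bv2]] : dist v b = 0 \/ dist v b = 1 \/ dist v b = 2 by lia.
  + have [x [d_vx d_xw]] := common_neighbor d_vw.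
    exists x; split=> //; have := dist_triangle v u x.
    rewrite (dist_eq0 bv0) in d_vx d_vw Duv Duw *.
    by rewrite distxx in Duv; lia.
  + exists b; split=> //; first by rewrite distxx in Dvw; lia.
    have := dist_triangle a u b; have := dist_sym v b.
    by rewrite distxx in Dvw; lia.
  + have [x [d_vx d_xw]] := common_neighbor d_vw.
    exists x; split=> //; have := dist_triangle w u x; have := dist_sym w x.
    have := dist_sym v b; rewrite distxx in Dvw; lia.
(* One of [v = b] and [c = w] holds; the other corner is the common neighbor, close enough to [u]
   since [b] and [c] are equidistant from [a]. *)
- have [[/dist_eq0 vb cw1] | [vb1 /dist_eq0 cw]] :
      dist v b = 0 /\ dist c w = 1 \/ dist v b = 1 /\ dist c w = 0 by lia.
  + exists c; rewrite vb; split=> //.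
    by have := dist_triangle a u c; rewrite -vb in eq_d_a Duv *; lia.
  + exists b; rewrite -cw; split=> //; have := dist_triangle a u b.
    by have := dist_sym v b; rewrite cw in eq_d_a Duw *; lia.
(* Now [v = b] and [w = c], and the middle vertex of the path is as far from [a] as they are. *)
- case: p e_p last_p size_p flat_p => [|x [|y [|? p]]] //=; rewrite ?bc2 //.
  move=> /and3P[/dist_edge bx /dist_edge xy _] y_c _ flat_p.
  have /dist_eq0 vb : dist v b = 0 by lia.
  have /dist_eq0 cw : dist c w = 0 by lia.
  rewrite y_c in xy; exists x; rewrite vb -cw.
  have := dist_triangle x b c; have := dist_triangle a u x.
  have := flat_p b x; rewrite !inE !eqxx orbT => /(_ isT isT).
  have := dist_sym a x; have := dist_sym a b.
  rewrite vb -cw in Duv Duw; split; lia.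
Qed.

End Distance.

Theorem theorem3 (G : cgraph) :
  meshed G <->
  (forall u v w : G, metric_triangle u v w ->
     exists2 p : seq G, shortest_path u v p &
       forall x y : G, x \in u :: p -> y \in u :: p -> dist x w = dist y w).
Proof.
split; last exact: triangle_path_meshed.
by move=> meshG u v w; apply: meshed_triangle_path.
Qed.
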